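(* For every integer $n\geq 3$, the $3$-extra connectivity of the $3$-ary $n$-cube satisfies $\kappa_{3}(Q_{n}^{3})=8n-12$.
   Context: The $3$-ary $n$-cube $Q_n^3$ is the graph whose vertices are the strings $u=u_{n-1}u_{n-2}\cdots u_0$ with $u_i\in\{0,1,2\}$, two vertices $u,v$ being adjacent if and only if there is an index $j$ with $u_j=v_j\pm 1 \pmod 3$ and $u_i=v_i$ for all $i\neq j$. For a connected graph $G$ and an integer $h\geq 0$, a vertex set $S\subseteq V(G)$ is an $h$-extra vertex cut if $G-S$ is disconnected and every component of $G-S$ has at least $h+1$ vertices; the $h$-extra connectivity $\kappa_h(G)$ is the minimum cardinality of an $h$-extra vertex cut of $G$. *)

(* Defs.v *)
From mathcomp Require Import all_boot all_order all_algebra.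

Set Implicit Arguments.
Unset Strict Implicit.
Unset Printing Implicit Defensive.

Import GRing.Theory.

(* A simple graph on T is given by its (symmetric, irreflexive) adjacency
   relation e : rel T. *)

Definition del_vertices (T : finType) (e : rel T) (S : {set T}) : rel T :=
  [rel x y | [&& x \notin S, y \notin S & e x y]].

Definition components (T : finType) (e : rel T) (S : {set T}) : {set {set T}} :=
  [set [set y | connect (del_vertices e S) x y] | x in ~: S].

Definition extra_cut (T : finType) (e : rel T) (h : nat) (S : {set T}) : bool :=
  (1 < #|components e S|) && [forall C in components e S, h.+1 <= #|C|].

(* "kappa_h(G) = k"; as a relation because a graph need not have an h-extra
   vertex cut, so that the equation also asserts the existence of one. *)
Definition is_extra_connectivity (T : finType) (e : rel T) (h k : nat) : Prop :=
  (exists2 S : {set T}, extra_cut e h S & #|S| = k) /\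
  (forall S : {set T}, extra_cut e h S -> k <= #|S|).

Definition ternary_cube (n : nat) : rel {ffun 'I_n -> 'Z_3} :=
  fun u v =>
    [exists j : 'I_n,
       ((u j == v j + 1)%R || (u j == v j - 1)%R) &&
       [forall i : 'I_n, (i != j) ==> (u i == v i)]].

Lemma ternary_cube_sym n : symmetric (@ternary_cube n).
Proof.
suff imp u v : @ternary_cube n u v -> @ternary_cube n v u.
  by move=> u v; apply/idP/idP; apply: imp.
case/existsP=> j /andP[uv_j /forallP uvP]; apply/existsP; exists j.
apply/andP; split; last first.
  by apply/forallP=> i; move: (uvP i); rewrite [u i == _]eq_sym.
by case/orP: uv_j => /eqP->; rewrite ?addrK ?subrK eqxx ?orbT.
Qed.

Lemma ternary_cube_irr n : irreflexive (@ternary_cube n).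
Proof.
move=> u; apply/negbTE/negP; case/existsP=> j /andP[+ _].
by case: (u j) => [[|[|[|//]]] ?].
Qed.

Lemma ternary_cube_connected n (u v : {ffun 'I_n -> 'Z_3}) :
  connect (@ternary_cube n) u v.
Proof.
have [m] := ubnP #|[set i | u i != v i]|; elim: m u => // m IHm u lt_uv.
have [->|/eqP neq_uv] := eqVneq u v; first exact: connect0.
have [j uv_j] : exists j, u j != v j.
  apply/existsP; apply: contra_notT neq_uv; rewrite negb_exists => /forallP uv.
  by apply/ffunP=> i; apply/eqP; move: (uv i); rewrite negbK.
pose w := [ffun i => if i == j then v j else u i].
apply: (@connect_trans _ _ w).
  apply/connect1/existsP; exists j; rewrite ffunE eqxx; apply/andP; split.
    by move: uv_j; case: (u j) (v j) => [[|[|[|//]]] ?] [[|[|[|//]]] ?].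
  by apply/forallP=> i; apply/implyP=> /negPf ij; rewrite ffunE ij.
apply: IHm; rewrite ltnS in lt_uv; apply: leq_trans lt_uv.
apply: proper_card; apply/properP; split.
  apply/subsetP=> i; rewrite !inE ffunE.
  by case: (eqVneq i j) => // ->; rewrite eqxx.
by exists j; rewrite !inE ?ffunE ?eqxx.
Qed.

(* Main.v *)
(** Lower bound: for a cut S, let A be one component of the complement and B the
    rest of it.  Slice the cube along its first coordinate into three layers of
    N = 3^(n-1) vertices.  Layerwise, A_i and B_i are again separated, and A_i,
    B_j have disjoint projections, so that #|A_i| + #|B_j| <= N for all i, j.
    These two facts alone, by linear arithmetic, propagate the lower bounds
    2n, 4n-3, 6n-7, 8n-12 on the size of a cut whose two sides both have at
    least 1, 2, 3, 4 vertices; in dimension n <= 2 the stronger information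
    that large separated sets do not exist is needed to start the induction.

    Upper bound: the neighbourhood of a 4-cycle contained in a 3 x 3 plane. *)

Require Import Defs.
From mathcomp Require Import all_boot all_order all_algebra.
From mathcomp Require Import zify.

Set Implicit Arguments.
Unset Strict Implicit.
Unset Printing Implicit Defensive.

(** * Adjacency and separated pairs *)

Lemma Z3_pm1 (x y : 'Z_3) : ((x == y + 1) || (x == y - 1))%R = (x != y).
Proof. by case: x y => [[|[|[|//]]] ?] [[|[|[|//]]] ?]. Qed.

(** Distinct residues modulo 3 always differ by 1 or -1, so the cube is the Hamming graph H(n,3). *)
Lemma ternary_cubeP n (u v : {ffun 'I_n -> 'Z_3}) :
  reflect (exists2 j, u j != v j & forall i, i != j -> u i = v i)
          (ternary_cube u v).
Proof.
apply: (iffP existsP) => [[j /andP[]]|[j uvj uv]].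
  rewrite Z3_pm1 => uvj /forallP uv; exists j => // i ij.
  by have /implyP/(_ ij)/eqP := uv i.
exists j; rewrite Z3_pm1 uvj; apply/forallP=> i; apply/implyP=> /uv->.
exact: eqxx.
Qed.

Lemma card_ternary n : #|{: {ffun 'I_n -> 'Z_3}}| = 3 ^ n.
Proof. by rewrite card_ffun !card_ord. Qed.

(** Unlike being a component, this relation passes to layers, so the induction runs on it. *)
Definition separated n (A B : {set {ffun 'I_n -> 'Z_3}}) : Prop :=
  forall u v, u \in A -> v \in B -> (u != v) && ~~ ternary_cube u v.

Lemma card_disjoint n (A B : {set {ffun 'I_n -> 'Z_3}}) :
  [disjoint A & B] -> #|A| + #|B| <= 3 ^ n.
Proof.
move=> dAB; rewrite -card_ternary.
by move: dAB; rewrite -leq_card_setU => /eqP <-; exact: max_card.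
Qed.

(** * Layers along the first coordinate *)

Definition cons_ffun n (i : 'Z_3) (u : {ffun 'I_n -> 'Z_3}) :
    {ffun 'I_n.+1 -> 'Z_3} :=
  [ffun k => if unlift ord0 k is Some j then u j else i].

Lemma cons_ffun0 n i (u : {ffun 'I_n -> 'Z_3}) : cons_ffun i u ord0 = i.
Proof. by rewrite ffunE unlift_none. Qed.

Lemma cons_ffunS n i (u : {ffun 'I_n -> 'Z_3}) j :
  cons_ffun i u (lift ord0 j) = u j.
Proof. by rewrite ffunE liftK. Qed.

Lemma cons_ffun_bij n :
  bijective (fun p : 'Z_3 * {ffun 'I_n -> 'Z_3} => cons_ffun p.1 p.2).
Proof.
exists (fun x : {ffun 'I_n.+1 -> 'Z_3} =>
          (x ord0, [ffun j => x (lift ord0 j)])).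
  case=> i u /=; rewrite cons_ffun0; congr pair; apply/ffunP=> j.
  by rewrite ffunE cons_ffunS.
move=> x; apply/ffunP=> k; case: (unliftP ord0 k) => [j|] -> /=.
  by rewrite cons_ffunS ffunE.
by rewrite cons_ffun0.
Qed.

Definition layer n (A : {set {ffun 'I_n.+1 -> 'Z_3}}) (i : 'Z_3) :=
  [set u | cons_ffun i u \in A].

Lemma card_layers n (A : {set {ffun 'I_n.+1 -> 'Z_3}}) :
  \sum_i #|layer A i| = #|A|.
Proof.
rewrite -[RHS]sum1_card (reindex _ (onW_bij _ (@cons_ffun_bij n))) /=.
rewrite (eq_bigr (fun i => \sum_(u | cons_ffun i u \in A) 1)) => [|i _].
  by rewrite pair_big_dep.
by rewrite -sum1_card; apply: eq_bigl => u; rewrite inE.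
Qed.

Lemma cons_ffun_adj n i (u v : {ffun 'I_n -> 'Z_3}) :
  ternary_cube u v -> ternary_cube (cons_ffun i u) (cons_ffun i v).
Proof.
case/ternary_cubeP=> j uvj uv; apply/ternary_cubeP; exists (lift ord0 j).
  by rewrite !cons_ffunS.
move=> k; case: (unliftP ord0 k) => [l|] ->; last by rewrite !cons_ffun0.
by rewrite (inj_eq lift_inj) !cons_ffunS; apply: uv.
Qed.

Lemma cons_ffun_adj0 n i j (u : {ffun 'I_n -> 'Z_3}) :
  i != j -> ternary_cube (cons_ffun i u) (cons_ffun j u).
Proof.
move=> ij; apply/ternary_cubeP; exists ord0; first by rewrite !cons_ffun0.
by move=> k; case: (unliftP ord0 k) => [l|] -> //; rewrite !cons_ffunS.
Qed.

Lemma separated_layer n (A B : {set {ffun 'I_n.+1 -> 'Z_3}}) i :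
  separated A B -> separated (layer A i) (layer B i).
Proof.
move=> sAB u v; rewrite !inE => uA vB; have /andP[neq nadj] := sAB _ _ uA vB.
apply/andP; split; first by apply: contraNneq neq => ->.
by apply: contra nadj; apply: cons_ffun_adj.
Qed.

(** A common projection would lift to a vertex of [A] and one of [B] that are equal if [i = j] and
    adjacent otherwise. *)
Lemma separated_card_layer n (A B : {set {ffun 'I_n.+1 -> 'Z_3}}) i j :
  separated A B -> #|layer A i| + #|layer B j| <= 3 ^ n.
Proof.
move=> sAB; apply: card_disjoint; apply/pred0P=> u /=; apply/negbTE/negP.
rewrite !inE => /andP[uA uB]; have := sAB _ _ uA uB.
have [->|ij] := eqVneq i j; first by rewrite eqxx.
by rewrite cons_ffun_adj0 ?andbF.
Qed.

(** * Arithmetic of layer sizes *)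

Lemma sum_Z3 (a : 'Z_3 -> nat) :
  \sum_i a i = a 0%R + a 1%R + a 2%R.
Proof.
rewrite !big_ord_recl big_ord0 addn0 addnA.
by congr (_ + a _ + a _); apply: val_inj.
Qed.

(** Dimension 2, with 9 vertices: the first two clauses are the cut bounds 2n = 4 and 4n-3 = 5; the
    last is the extra information that starts the induction. *)
Definition sep_bound2 (a b : nat) : Prop :=
  [/\ 1 <= a -> 1 <= b -> a + b <= 5,
      2 <= a -> 2 <= b -> a + b <= 4
    & a <= 2 \/ b <= 2].

(* The complement of A and B has N - a - b vertices; subtractions are moved to
   the other side because of truncation. *)
Definition sep_bound (n N a b : nat) : Prop :=
  [/\ 1 <= a -> 1 <= b -> a + b + 2 * n <= N,
      2 <= a -> 2 <= b -> a + b + 4 * n <= N + 3,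
      3 <= a -> 3 <= b -> a + b + 6 * n <= N + 7
    & 4 <= a -> 4 <= b -> a + b + 8 * n <= N + 12].

Section Arithmetic.
Variables (a b : 'Z_3 -> nat) (N : nat).
Hypothesis layers : forall i j, a i + b j <= N.

Lemma sep_bound1_step : N = 1 -> \sum_i a i = 0 \/ \sum_i b i = 0.
Proof using layers.
move=> N1; rewrite !sum_Z3.
move: (layers 0%R 0%R) (layers 0%R 1%R) (layers 0%R 2%R).
move: (layers 1%R 0%R) (layers 1%R 1%R) (layers 1%R 2%R).
move: (layers 2%R 0%R) (layers 2%R 1%R) (layers 2%R 2%R).
by lia.
Qed.

Lemma sep_bound2_step :
  N = 3 -> (forall i, a i = 0 \/ b i = 0) ->
  sep_bound2 (\sum_i a i) (\sum_i b i).
Proof using layers.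
move=> N3 ab0; rewrite !sum_Z3.
move: (layers 0%R 0%R) (layers 0%R 1%R) (layers 0%R 2%R).
move: (layers 1%R 0%R) (layers 1%R 1%R) (layers 1%R 2%R).
move: (layers 2%R 0%R) (layers 2%R 1%R) (layers 2%R 2%R).
by move: (ab0 0%R) (ab0 1%R) (ab0 2%R); do 3 case=> ->; split; lia.
Qed.

Lemma sep_bound3_step :
  N = 9 -> (forall i, sep_bound2 (a i) (b i)) ->
  sep_bound 3 27 (\sum_i a i) (\sum_i b i).
Proof using layers.
move=> N9 bnd; rewrite !sum_Z3.
(* Cases by the smaller size: two sizes of at least 2 with sum at most 4 are both 2. *)
have {}bnd i : (a i = 0 \/ b i = 0) \/ (a i = 1 \/ b i = 1) /\ a i + b i <= 5
               \/ (a i = 2 /\ b i = 2).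
  by have [] := bnd i; lia.
move: (layers 0%R 0%R) (layers 0%R 1%R) (layers 0%R 2%R).
move: (layers 1%R 0%R) (layers 1%R 1%R) (layers 1%R 2%R).
move: (layers 2%R 0%R) (layers 2%R 1%R) (layers 2%R 2%R).
move: (bnd 0%R) (bnd 1%R) (bnd 2%R).
by do 3 case=> [?|[[? ?]|[? ?]]]; split; lia.
Qed.

(** If only one [a i] is nonzero and it is at least k, the two other [b j] are at most [N - k], a
    gain of 2k; hence the coefficients 2, 4, 6, 8. If no layer meets both sides, the total is at
    most [2 * N], and [9 * n <= N] suffices. *)
Lemma sep_bound_step n :
  3 <= n -> 9 * n <= N -> (forall i, sep_bound n N (a i) (b i)) ->
  sep_bound n.+1 (3 * N) (\sum_i a i) (\sum_i b i).
Proof using layers.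
move=> n3 nN bnd; rewrite !sum_Z3.
(* Cases by the smaller size in the layer: 0, 1, 2, 3, or at least 4. *)
have {}bnd i : (a i = 0 \/ b i = 0) \/
    ((a i = 1 \/ b i = 1) /\ a i + b i + 2 * n <= N) \/
    ((a i = 2 \/ b i = 2) /\ a i + b i + 4 * n <= N + 3) \/
    ((a i = 3 \/ b i = 3) /\ a i + b i + 6 * n <= N + 7) \/
    (4 <= a i /\ 4 <= b i /\ a i + b i + 8 * n <= N + 12).
  by have [] := bnd i; lia.
move: (layers 0%R 0%R) (layers 0%R 1%R) (layers 0%R 2%R).
move: (layers 1%R 0%R) (layers 1%R 1%R) (layers 1%R 2%R).
move: (layers 2%R 0%R) (layers 2%R 1%R) (layers 2%R 2%R).
move: (bnd 0%R) (bnd 1%R) (bnd 2%R).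
move: (a 0%R) (a 1%R) (a 2%R) (b 0%R) (b 1%R) (b 2%R) => ? ? ? ? ? ?.
by do 3 case=> [?|[[? ?]|[[? ?]|[[? ?]|[? [? ?]]]]]]; split=> ? ?; lia.
Qed.

End Arithmetic.

(** * Size bounds for separated pairs, by dimension *)

Lemma separated1 (A B : {set {ffun 'I_1 -> 'Z_3}}) :
  separated A B -> #|A| = 0 \/ #|B| = 0.
Proof.
move=> sAB; rewrite -!card_layers; apply: (@sep_bound1_step _ _ 1) => // i j.
exact: separated_card_layer.
Qed.

Lemma separated2 (A B : {set {ffun 'I_2 -> 'Z_3}}) :
  separated A B -> sep_bound2 #|A| #|B|.
Proof.
move=> sAB; rewrite -!card_layers.
apply: (@sep_bound2_step _ _ 3) => // [i j|i].
  exact: separated_card_layer.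
exact/separated1/separated_layer.
Qed.

Lemma leq_9n_3X n : 3 <= n -> 9 * n <= 3 ^ n.
Proof.
elim: n => // n IHn; rewrite ltnS leq_eqVlt => /orP[/eqP<- //|n3].
by have := IHn n3; rewrite expnS; lia.
Qed.

Lemma separated_sep_bound n (A B : {set {ffun 'I_n -> 'Z_3}}) :
  3 <= n -> separated A B -> sep_bound n (3 ^ n) #|A| #|B|.
Proof.
elim: n A B => // n IHn A B; rewrite ltnS leq_eqVlt => /orP[/eqP n2|n3] sAB.
  (* Dimension 3 is the base, fed by the planar bounds: [sep_bound_step] cannot start from dimension
     2, where 9n = 18 exceeds 9. *)
  case: n / n2 {IHn} A B sAB => A B sAB.
  rewrite -!card_layers; apply: (@sep_bound3_step _ _ 9) => // [i j|i].
    exact: separated_card_layer.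
  exact/separated2/separated_layer.
rewrite -!card_layers expnS; apply: sep_bound_step => // [i j||i].
- exact: separated_card_layer.
- exact: leq_9n_3X.
- exact/IHn/separated_layer.
Qed.

(** * Lower bound for cuts *)

Lemma del_vertices_sym n (S : {set {ffun 'I_n -> 'Z_3}}) :
  symmetric (del_vertices (@ternary_cube n) S).
Proof.
by move=> u v; apply/and3P/and3P=> -[? ?]; rewrite ternary_cube_sym; split.
Qed.

Lemma extra_cut_card n (S : {set {ffun 'I_n -> 'Z_3}}) :
  3 <= n -> extra_cut (@ternary_cube n) 3 S -> 8 * n - 12 <= #|S|.
Proof.
move=> n3 /andP[/card_gt1P[C [D [CS DS CD]]] /forall_inP big].
have [C4 D4] := (big _ CS, big _ DS).
pose e := del_vertices (@ternary_cube n) S.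
have csym : connect_sym e by apply: sym_connect_sym; apply: del_vertices_sym.
have Scl : closed e S by move=> u v /and3P[/negPf-> /negPf->].
case/imsetP: CS CD C4 => x xS ->; case/imsetP: DS D4 => y yS -> D4 CD C4.
move: xS yS; rewrite !inE => xS yS.
(* With all of the rest as [B], not just the component of [y], the sets [A], [S], [B] partition the
   cube. *)
pose A := [set z | connect e x z]; pose B := ~: (A :|: S).
have AS : [disjoint A & S].
  apply/pred0P=> z /=; rewrite inE; apply/negbTE/negP=> /andP[xz].
  by rewrite -(closed_connect Scl xz) (negPf xS).
have xy : ~~ connect e x y.
  apply: contra CD => xy; apply/eqP/setP=> z; rewrite !inE.
  exact: same_connect.
have DB : [set z | connect e y z] \subset B.
  apply/subsetP=> z; rewrite !inE => yz.
  rewrite -(closed_connect Scl yz) (negPf yS) orbF.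
  by rewrite csym -(same_connect csym yz) csym.
have sAB : separated A B.
  move=> u v uA; rewrite !inE negb_or => /andP[vA vS].
  have uS : u \notin S by rewrite (disjointFr AS uA).
  rewrite inE in uA; apply/andP; split; first by apply: contraNneq vA => <-.
  apply: contra vA => uv; apply: connect_trans uA (connect1 _).
  by apply/and3P.
have [_ _ _ bound] := separated_sep_bound n3 sAB.
have {bound} : #|A| + #|B| + 8 * n <= 3 ^ n + 12.
  exact: bound C4 (leq_trans D4 (subset_leq_card DB)).
have : #|A| + #|S| + #|B| = 3 ^ n.
  rewrite -card_ternary -(cardsC (A :|: S)); congr (_ + _).
  by apply/eqP; rewrite eq_sym (leq_card_setU A S).
by move: #|A| #|B| #|S| => p q r; lia.
Qed.

(** * The cut around a 4-cycle *)

Lemma leq_card_bigcup (I T : finType) (B : I -> {set T}) :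
  #|\bigcup_i B i| <= \sum_i #|B i|.
Proof.
elim/big_rec2: _ => [|i m C _ le_Cm]; first by rewrite cards0.
by apply: leq_trans (leq_card_setU _ _) _; rewrite leq_add2l.
Qed.

(* Coordinate values of the 4-cycle [{0,1} x {0,1} x {0} x ... x {0}]; the cut
   is the set of vertices with exactly one coordinate off these values. *)
Definition good n (i : 'I_n) (x : 'Z_3) :=
  if i < 2 then (x != 2)%R else (x == 0)%R.

Definition off n (u : {ffun 'I_n -> 'Z_3}) := [set i | ~~ good i (u i)].

Definition cycle_cut n := [set u | #|@off n u| == 1].

Definition upd n (u : {ffun 'I_n -> 'Z_3}) i (c : 'Z_3) : {ffun 'I_n -> 'Z_3} :=
  [ffun k => if k == i then c else u k].

(** Coordinates are set to [c] one at a time, staying in [P] and so off [S]. Used with [c = 0] on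
    the cycle and [c = 2] beyond the cut. *)
Lemma connect_const n (S : {set {ffun 'I_n -> 'Z_3}}) (P : pred _) c u :
  (forall v, P v -> v \notin S) -> (forall v i, P v -> P (upd v i c)) ->
  P u -> connect (del_vertices (@ternary_cube n) S) u [ffun=> c].
Proof.
move=> PS Pupd.
have [m] := ubnP #|[set i | u i != c]|; elim: m u => // m IHm u lt_u Pu.
have [u_c|[j]] := set_0Vmem [set i | u i != c].
  suff -> : u = [ffun=> c] by apply: connect0.
  apply/ffunP=> i; have := in_set0 i; rewrite -u_c inE ffunE => /negbT.
  by rewrite negbK => /eqP.
rewrite inE => uj; apply: (@connect_trans _ _ (upd u j c)).
  apply/connect1/and3P; split; [exact: PS|exact/PS/Pupd|].
  apply/ternary_cubeP; exists j.
    by rewrite ffunE eqxx.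
  by move=> i /negPf ij; rewrite ffunE ij.
apply: IHm (Pupd _ _ Pu); rewrite ltnS in lt_u; apply: leq_trans lt_u.
apply: proper_card; apply/properP; split.
  apply/subsetP=> i; rewrite !inE ffunE.
  by case: (eqVneq i j) => // ->; rewrite eqxx.
by exists j; rewrite !inE ?ffunE ?eqxx.
Qed.

Lemma leq_off_adj n (u v : {ffun 'I_n -> 'Z_3}) :
  ternary_cube u v -> #|off v| <= #|off u|.+1.
Proof.
case/ternary_cubeP=> j _ uv; apply: (@leq_trans #|j |: off u|).
  apply: subset_leq_card; apply/subsetP=> i; rewrite !inE.
  by case: eqVneq => //= /uv->.
by rewrite cardsU1; case: (j \notin _).
Qed.

(** The value 2 is bad at every coordinate; dually, 0 is good at every one. *)
Lemma leq_off_upd2 n (u : {ffun 'I_n -> 'Z_3}) i :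
  #|off u| <= #|off (upd u i 2%R)|.
Proof.
apply: subset_leq_card; apply/subsetP=> j; rewrite !inE ffunE.
by case: eqVneq => // ->; rewrite /good; case: ifP.
Qed.

Lemma leq_off_upd0 n (u : {ffun 'I_n -> 'Z_3}) i :
  #|off (upd u i 0%R)| <= #|off u|.
Proof.
apply: subset_leq_card; apply/subsetP=> j; rewrite !inE ffunE.
by case: eqVneq => // ->; rewrite /good; case: ifP.
Qed.

Lemma off0 n : #|off [ffun=> 0%R : 'Z_3] : {set 'I_n}| = 0.
Proof.
by apply: eq_card0 => i; rewrite !inE ffunE /good; case: ifP.
Qed.

Lemma off2 n : #|off [ffun=> 2%R : 'Z_3] : {set 'I_n}| = n.
Proof.
rewrite -[RHS]card_ord; apply: eq_card => i.
by rewrite !inE ffunE /good; case: ifP.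
Qed.

Lemma card_family_prod n (F : 'I_n -> pred 'Z_3) :
  #|family F| = \prod_i #|F i|.
Proof. by rewrite card_family foldrE big_map big_enum. Qed.

Lemma card_good n (i : 'I_n) : #|good i| = if i < 2 then 2 else 1.
Proof.
have [lt_i2|ge_i2] := ifP.
  transitivity #|predC1 (2%R : 'Z_3)|; last by rewrite cardC1 card_ord.
  apply: eq_card => x.
  by rewrite !inE /good lt_i2.
transitivity #|pred1 (0%R : 'Z_3)|; last by rewrite card1.
by apply: eq_card => x; rewrite !inE /good ge_i2.
Qed.

Lemma card_bad n (i : 'I_n) : #|predC (good i)| = if i < 2 then 1 else 2.
Proof.
have : #|good i| + #|predC (good i)| = 3 := etrans (cardC _) (card_ord 3).
by rewrite card_good; case: ifP => _ [].
Qed.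

Lemma prod_card_good n : \prod_(i < n.+2) #|good i| = 4.
Proof.
rewrite !big_ord_recl !card_good /= big1 // => i _.
by rewrite card_good.
Qed.

Lemma card_cycle n : 2 <= n -> #|[set u | #|@off n u| == 0]| = 4.
Proof.
case: n => [|[|n]] // _.
transitivity #|family (fun i : 'I_n.+2 => good i)|.
  apply: eq_card => u; rewrite inE cards_eq0; apply/eqP/familyP=> [u0 i|u_good].
    by have := in_set0 i; rewrite -u0 inE => /negbT; rewrite negbK.
  by apply/setP=> i; rewrite !inE; apply/negbTE; rewrite negbK; apply: u_good.
by rewrite card_family_prod prod_card_good.
Qed.

(** Sorting by the bad coordinate [i] gives 2 vertices for each of the two [i < 2] and 8 for each of
    the others: 4 + 8(n-2) = 8n-12. *)
Lemma card_cycle_cut n : 2 <= n -> #|cycle_cut n| <= 8 * n - 12.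
Proof.
case: n => [|[|n]] // _.
pose F (i j : 'I_n.+2) : pred 'Z_3 :=
    if j == i then (predC (good j) : pred 'Z_3) else good j.
apply: (@leq_trans (\sum_i #|family (F i)|)).
  pose G i := [set u | u \in family (F i)].
  have <- : \sum_i #|G i| = \sum_i #|family (F i)|.
    by apply: eq_bigr => i _; rewrite cardsE.
  apply: leq_trans (leq_card_bigcup G); apply: subset_leq_card.
  apply/subsetP=> u; rewrite inE => /cards1P[i ui].
  apply/bigcupP; exists i; rewrite // inE; apply/familyP=> j.
  have := in_set1 j i; rewrite -ui inE /F; case: eqP => _ /=; last first.
    by move/negbT; rewrite negbK.
  by [].
(* In the product 4 that counts the cycle, the factor at [i] is exchanged: 2 becomes 1 if [i < 2],
   otherwise 1 becomes 2. *)
have prodF i : \prod_j #|F i j| = if i < 2 then 2 else 8.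
  rewrite (bigD1 i) //= /F eqxx card_bad.
  rewrite (eq_bigr (fun j => #|good j|)) => [|j /negPf-> //].
  have := prod_card_good n; rewrite (bigD1 i) //= card_good.
  by case: ifP => _; lia.
under eq_bigr => i _ do rewrite card_family_prod prodF.
rewrite !big_ord_recl /= sum_nat_const card_ord; lia.
Qed.

Lemma cycle_cut_extra n : 3 <= n -> extra_cut (@ternary_cube n) 3 (cycle_cut n).
Proof.
move=> n3; pose S := cycle_cut n; pose e := del_vertices (@ternary_cube n) S.
have csym : connect_sym e by apply/sym_connect_sym/del_vertices_sym.
pose A := [set u | #|@off n u| == 0]; pose B := [set u | 1 < #|@off n u|].
pose z0 : {ffun 'I_n -> 'Z_3} := [ffun=> 0%R].
pose z2 : {ffun 'I_n -> 'Z_3} := [ffun=> 2%R].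
have AS u : u \in A -> u \notin S by rewrite !inE => /eqP->.
have BS u : u \in B -> u \notin S by rewrite !inE => /gtn_eqF->.
have z0A : z0 \in A by rewrite inE off0.
have z2B : z2 \in B by rewrite inE off2 ltnW.
have Az0 u : u \in A -> connect e u z0.
  apply: (@connect_const _ _ (fun v => v \in A)) => // v i.
  rewrite !inE -!leqn0.
  exact: leq_trans (leq_off_upd0 _ _).
have Bz2 u : u \in B -> connect e u z2.
  apply: (@connect_const _ _ (fun v => v \in B)) => // v i.
  rewrite !inE => /leq_trans; apply.
  exact: leq_off_upd2.
have AB u : u \notin S -> u \in A \/ u \in B.
  by rewrite !inE; case: #|off u| => [|[|k]] // _; [left | right].
(* An edge changes the number of bad coordinates by at most 1, so leaving count 0 means entering
   [S]. *)
have Acl : closed e A.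
  move=> u v /and3P[uS vS uv]; have vu := uv; rewrite ternary_cube_sym in vu.
  move: uS vS (leq_off_adj uv) (leq_off_adj vu); rewrite !inE.
  by case: #|off u| #|off v| => [|[|k]] [|[|l]].
have A4 : 4 <= #|A| by rewrite card_cycle // ltnW.
(* At least 9n - 4 - (8n - 12) = n + 8 vertices remain. *)
have B4 : 4 <= #|B|.
  have : #|A :|: S| + #|B| = 3 ^ n.
    rewrite -card_ternary -(cardsC (A :|: S)); congr (_ + _).
    apply: eq_card => u; rewrite !inE.
    by case: #|off u| => [|[|k]].
  have : #|A :|: S| <= 4 + #|S|.
    by rewrite -(card_cycle (ltnW n3)); apply: leq_card_setU.
  have := card_cycle_cut (ltnW n3); have := leq_9n_3X n3; rewrite -/S.
  by move: #|A :|: S| #|S| #|B| => p q r; lia.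
(* The component of [u] contains [P], since all of [P] is joined to the hub [z]. *)
have comp4 u (P : {set _}) z :
    (forall v, v \in P -> connect e v z) -> u \in P -> 4 <= #|P| ->
  4 <= #|[set y | connect e u y]|.
  move=> Pz uP /leq_trans; apply; apply/subset_leq_card/subsetP=> v vP.
  by rewrite inE (connect_trans (Pz _ uP)) // csym Pz.
apply/andP; split.
  apply/card_gt1P; exists [set y | connect e z0 y], [set y | connect e z2 y].
  split; first by apply/imset_f; rewrite inE AS.
    by apply/imset_f; rewrite inE BS.
  apply/eqP=> /setP/(_ z2); rewrite !inE connect0 => z02.
  by move: z2B; rewrite inE; have := closed_connect Acl z02;
     rewrite z0A inE => /esym/eqP->.
apply/forall_inP=> C /imsetP[u]; rewrite inE => /AB uAB ->.
by case: uAB => uP; [exact: comp4 Az0 uP A4 | exact: comp4 Bz2 uP B4].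
Qed.

Theorem theorem3p8 (n : nat) (hn : 3 <= n) :
  is_extra_connectivity (@ternary_cube n) 3 (8 * n - 12).
Proof.
have cut := cycle_cut_extra hn; split; last by move=> S; apply: extra_cut_card.
(* The size is exact because the lower bound applies to this cut too. *)
exists (cycle_cut n) => //; apply/eqP; rewrite eqn_leq.
by rewrite card_cycle_cut ?extra_cut_card // ltnW.
Qed.
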